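(* Let $p>2$ be a prime and let $G$ be a finite group with an abelian Sylow $p$-subgroup $P$. Let $E=N_G(P)/C_G(P)$ and let $W$ be the subgroup of $E$ generated by the elements acting as reflections on $\Omega_1(P)$, viewed as an $\mathbf{F}_p$-vector space. If $H^2(G,\mathbf{F}_p)\neq 0$, then $\Omega_1(P)^W\neq 0$.
   Context: For an abelian group $P$, $\Omega_1(P)$ denotes the subgroup of elements of order $1$ or $p$, an $\mathbf{F}_p$-vector space on which $E$ acts (faithfully) by conjugation. A reflection on a finite-dimensional vector space $M$ over a field is an invertible linear map $s$ of finite order such that $M/\ker(s-1)$ has dimension $1$ (it is not required that $s^2=1$). $H^2(G,\mathbf{F}_p)$ is group cohomology with trivial coefficients, and $\Omega_1(P)^W$ is the subspace of $W$-fixed points. *)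

(* Defs.v *)
From HB Require Import structures.
From mathcomp Require Import all_boot all_order all_algebra.
From mathcomp Require Import all_fingroup all_solvable all_character.
From mathcomp Require Import boolp.

Set Implicit Arguments.
Unset Strict Implicit.
Unset Printing Implicit Defensive.

Import GRing.Theory.
Local Open Scope group_scope.
Local Open Scope ring_scope.

(* {ffun I -> A} with the finGroupType structure of its pointwise addition, so *)
(* that H2 below is a quotient of finite groups.                               *)
Definition cochain (I : finType) (A : finZmodType) : predArgType :=
  {ffun I -> A}.
HB.instance Definition _ (I : finType) (A : finZmodType) :=
  GRing.Zmodule.copy (cochain I A) {ffun I -> A}.
HB.instance Definition _ (I : finType) (A : finZmodType) :=
  Finite.copy (cochain I A) {ffun I -> A}.
HB.instance Definition _ (I : finType) (A : finZmodType) :=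
  [finGroupMixin of cochain I A for +%R].

Section SecondCohomology.

Variables (gT : finGroupType) (A : finZmodType).

(* Inhomogeneous (bar) cochains, with trivial action of gT on A.               *)
Definition cobound1 (u : cochain gT A) : cochain (gT * gT)%type A :=
  [ffun x : gT * gT => u x.2 - u (x.1 * x.2)%g + u x.1].

Definition cobound2 (f : cochain (gT * gT)%type A) :
    cochain (gT * gT * gT)%type A :=
  [ffun x : gT * gT * gT => let: (g, h, k) := x in
     f (h, k) - f ((g * h)%g, k) + f (g, (h * k)%g) - f (g, h)].

Definition cocycles2 : {set cochain (gT * gT)%type A} :=
  [set f | cobound2 f == 0].

Definition cobounds2 : {set cochain (gT * gT)%type A} :=
  [set cobound1 u | u : cochain gT A].

Fact cobound1D u v : cobound1 (u + v) = cobound1 u + cobound1 v.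
Proof.
apply/ffunP; case=> g h.
by rewrite !ffunE opprD (addrACA (u _)) [LHS]addrACA.
Qed.

Fact cobound2D f f' : cobound2 (f + f') = cobound2 f + cobound2 f'.
Proof.
apply/ffunP; case=> -[g h] k; rewrite !ffunE !opprD.
by rewrite (addrACA (f _)) (addrACA (f _ - f _)) [LHS]addrACA.
Qed.

Fact cocycles2_group_set : group_set cocycles2.
Proof.
have d0 : cobound2 0 = 0.
  by apply: (addrI (cobound2 0)); rewrite -cobound2D !addr0.
apply/group_setP; split=> [|f f']; rewrite !inE; first exact/eqP.
by move=> /eqP df /eqP df'; apply/eqP; rewrite [LHS]cobound2D df df' addr0.
Qed.
Canonical cocycles2_group := Group cocycles2_group_set.

Fact cobounds2_group_set : group_set cobounds2.
Proof.
have d0 : cobound1 0 = 0.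
  by apply: (addrI (cobound1 0)); rewrite -cobound1D !addr0.
apply/group_setP; split=> [|_ _ /imsetP[u _ ->] /imsetP[v _ ->]]; apply/imsetP.
  by exists 0.
by exists (u + v) => //; rewrite cobound1D.
Qed.
Canonical cobounds2_group := Group cobounds2_group_set.

Lemma cobounds2_sub : cobounds2 \subset cocycles2.
Proof.
apply/subsetP=> _ /imsetP[u _ ->]; rewrite inE.
apply/eqP/ffunP; case=> -[g h] k; rewrite !ffunE /= mulgA !opprD !opprK !addrA.
rewrite [LHS](ACl (1*4*(2*7)*(3*10)*(5*8)*(6*11)*(9*12))) /=.
by rewrite !(subrr, addNr, addr0).
Qed.

Definition H2 : {set coset_of cobounds2} := (cocycles2 / cobounds2)%g.

End SecondCohomology.

Definition is_reflection (K : fieldType) (M : vectType K) (s : 'End(M)) :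
    Prop :=
  [/\ lker s = 0%VS,
      exists2 n, (0 < n)%N & forall v, iter n s v = v
    & (\dim {:M} - \dim (lker (s - \1%VF)%R))%N = 1%N].

(* An elementary abelian p-group seen as an 'F_p-vector space, with            *)
(* x + y := x * y and a *: x := x ^+ a.                                        *)
Section ElementaryAbelianSpace.

Variables (gT : finGroupType) (p : nat) (A : {group gT}).

Definition abelem_space of (p.-abelem A)%g : predArgType := subg_of A.

Variable abelA : (p.-abelem A)%g.
Local Notation V := (abelem_space abelA).

HB.instance Definition _ := Finite.copy V (subg_of A).

Let add (x y : V) : V := ((x : subg_of A) * (y : subg_of A))%g.
Let opp (x : V) : V := (x : subg_of A)^-1%g.
Let zero : V := (1 : subg_of A)%g.

Fact abelem_space_addA : associative add. Proof. exact: mulgA. Qed.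
Fact abelem_space_addC : commutative add.
Proof.
move=> x y; apply: val_inj; rewrite /=.
exact: (centsP (abelem_abelian abelA) _ (subgP x) _ (subgP y)).
Qed.
Fact abelem_space_add0 : left_id zero add. Proof. exact: mul1g. Qed.
Fact abelem_space_addN : left_inverse zero opp add. Proof. exact: mulVg. Qed.

HB.instance Definition _ := GRing.isZmodule.Build V
  abelem_space_addA abelem_space_addC abelem_space_add0 abelem_space_addN.

Let scale (a : 'F_p) (x : V) : V := ((x : subg_of A) ^+ a)%g.

Fact abelem_space_expg_mod (x : V) n :
  ((x : subg_of A) ^+ (n %% (Zp_trunc (pdiv p)).+2) = (x : subg_of A) ^+ n)%g.
Proof.
have [-> | ntx] := eqVneq (x : subg_of A) 1%g; first by rewrite !expg1n.
have pA := abelem_pgroup abelA.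
have ntA : (A :!=: 1)%g.
  apply: contra ntx => /eqP A1; have := subgP x; rewrite A1 inE => xE.
  by apply/eqP/val_inj/eqP.
have [p_pr _ _] := pgroup_pdiv pA ntA.
rewrite [pdiv p]pdiv_id // Zp_cast ?prime_gt1 // [in RHS](divn_eq n p).
suff xp : ((x : subg_of A) ^+ p = 1)%g.
  by rewrite expgD mulnC expgM xp expg1n mul1g.
have [_ expA] := abelemP p_pr abelA.
by apply: val_inj; rewrite /= (morphX (sgval_morphism A)) ?inE ?expA ?subgP.
Qed.

Fact abelem_space_scaleA a b x : scale a (scale b x) = scale (a * b) x.
Proof. by rewrite /scale -expgM mulnC -[LHS]abelem_space_expg_mod. Qed.
Fact abelem_space_scale1 : left_id 1 scale.
Proof. by move=> x; rewrite /scale /= modn_small. Qed.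
Fact abelem_space_scaleDr : right_distributive scale +%R.
Proof.
move=> a x y; apply: expgMn; apply: val_inj.
exact: (centsP (abelem_abelian abelA) _ (subgP x) _ (subgP y)).
Qed.
Fact abelem_space_scaleDl x : {morph scale^~ x : a b / a + b}.
Proof. by move=> a b; rewrite /scale abelem_space_expg_mod expgD. Qed.

HB.instance Definition _ := GRing.Zmodule_isLmodule.Build 'F_p V
  abelem_space_scaleA abelem_space_scale1
  abelem_space_scaleDr abelem_space_scaleDl.

Definition abelem_space_dim : nat := logn p #|A|.

Fact abelem_space_vect : vector_axiom_def abelem_space_dim V.
Proof.
rewrite /abelem_space_dim; have [A1 | ntA] := eqVneq (gval A) 1%g.
  have inA1 z : z \in A -> z = 1%g by rewrite A1 => /set1P.
  have V0 (x y : V) : x = y.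
    apply: val_inj.
    exact: etrans (inA1 _ (subgP x)) (esym (inA1 _ (subgP y))).
  have -> : logn p #|A| = 0%N by rewrite A1 cards1 logn1.
  exists (fun=> 0).
    by move=> a x y; rewrite scaler0 addr0.
  by exists (fun=> 0) => [x | u]; [apply: V0 | rewrite [u]thinmx0].
rewrite -(dim_abelemE abelA ntA).
exists (fun x : V => abelem_rV abelA ntA (sgval x)).
  move=> a x y.
  have -> : sgval (a *: x + y) = (sgval x ^+ a * sgval y)%g.
    by rewrite -(morphX (sgval_morphism A)) ?inE.
  by rewrite abelem_rV_M ?groupX ?subgP // abelem_rV_X ?subgP // natr_Zp.
exists (fun u => subg A (rVabelem abelA ntA u)) => [x | u].
  by apply: val_inj; rewrite /= abelem_rV_K ?subgP // sgvalK.
by rewrite subgK ?mem_rVabelem // rVabelemK.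
Qed.

HB.instance Definition _ :=
  Lmodule_hasFinDim.Build 'F_p V abelem_space_vect.

End ElementaryAbelianSpace.

Section Omega1.

Variables (gT : finGroupType) (p : nat) (G P : {group gT}).
Hypotheses (sylP : (p.-Sylow(G) P)%g) (abP : abelian P).

Definition Omega1_space : vectType 'F_p :=
  abelem_space (Ohm1_abelem (pHall_pgroup sylP) abP).

(* On the group 'Ohm_1(P), the library action 'J %% 'C_G(P) sends x and the    *)
(* coset of g to x ^ g (Omega1_actE).                                          *)
Definition Omega1_conj (e : coset_of 'C_G(P)) (v : Omega1_space) :
    Omega1_space :=
  subg 'Ohm_1(P) (('J %% 'C_G(P))%act (sgval v) e).

Definition Omega1_act (e : coset_of 'C_G(P)) : 'End(Omega1_space) :=
  linfun (Omega1_conj e).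

Fact Omega1_conjE (g : gT) (v : Omega1_space) : g \in 'N_G(P) ->
  sgval (Omega1_conj (coset 'C_G(P) g) v) = (sgval v ^ g)%g.
Proof.
move=> NPg; have Ov : sgval v \in 'Ohm_1(P) := subgP v.
have Pv : sgval v \in P := subsetP (Ohm_sub 1 P) _ Ov.
have Ng : g \in 'N('C_G(P)) := subsetP (subcent_norm G P) _ NPg.
have Cv : sgval v \in 'Fix_'J(setT :&: 'C_G(P)).
  rewrite setTI afixJ; apply: subsetP Pv.
  by rewrite centsC subsetIr.
rewrite /Omega1_conj /= modactE ?in_setT //.
rewrite subgK //= memJ_norm //; have [_ /=] := setIP NPg.
by apply/subsetP/char_norms/Ohm_char.
Qed.

Fact Omega1_conj_linear (g : gT) : g \in 'N_G(P) ->
  linear (Omega1_conj (coset 'C_G(P) g)).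
Proof.
move=> NPg a u v; apply: val_inj.
have sgvalZD x y :
    sgval (a *: x + y : Omega1_space) = (sgval x ^+ a * sgval y)%g.
  by rewrite -(morphX (sgval_morphism _)) ?inE.
have := Omega1_conjE (a *: u + v) NPg; rewrite !sgvalZD conjMg conjXg.
by rewrite -!Omega1_conjE // -sgvalZD.
Qed.

Lemma Omega1_actE (g : gT) (v : Omega1_space) : g \in 'N_G(P) ->
  sgval (Omega1_act (coset 'C_G(P) g) v) = (sgval v ^ g)%g.
Proof.
move=> NPg; rewrite -Omega1_conjE // /Omega1_act.
pose f := Omega1_conj (coset 'C_G(P) g).
pose fL := GRing.isLinear.Build 'F_p Omega1_space Omega1_space _ f
  (Omega1_conj_linear NPg).
pose F : {linear Omega1_space -> Omega1_space} := HB.pack f fL.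
by rewrite (lfunE F).
Qed.

Definition reflection_subgroup : {set coset_of 'C_G(P)} :=
  <<[set e in ('N_G(P) / 'C_G(P))%g | `[< is_reflection (Omega1_act e) >]]>>%g.

Definition Omega1_fix (W : {set coset_of 'C_G(P)}) : {vspace Omega1_space} :=
  (\bigcap_(e in W) fixedSpace (Omega1_act e))%VS.

End Omega1.

(* Main.v *)
(* A non-trivial class in H^2(G, F_p) is a central extension X of G by a group *)
(* Z of order p that does not split; by Gaschuetz's theorem it does not split  *)
(* over the preimage Q of P either. Let H be a complement to P in N_G(P), and  *)
(* let K <= H be generated by the elements acting on Omega_1(P) as             *)
(* reflections: it is a p'-group with the same fixed points on P as W. Suppose *)
(* C_P(K) = 1, so that P = [P, K]. Each reflection s has [P, s] cyclic, hence  *)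
(* [P, s] lifts into Z(Q); so does all of P = [P, K], and Q is abelian. The    *)
(* p-power map from the preimage of Omega_1(P) to Z is then a K-invariant      *)
(* homomorphism, so it kills the preimage of [Omega_1(P), K] = Omega_1(P). So  *)
(* Z meets Phi(Q) trivially and has a complement in Q, a contradiction.        *)

From HB Require Import structures.
Require Import Defs.
From mathcomp Require Import all_boot all_order all_algebra.
From mathcomp Require Import all_fingroup all_solvable all_character.
From mathcomp Require boolp.

Set Implicit Arguments.
Unset Strict Implicit.
Unset Printing Implicit Defensive.

Import GRing.Theory.
Local Open Scope group_scope.

(** The heart is that a reflection moves [P] only along a cyclic subgroup
    ([reflection_commg_cyclic]), and a central extension of a cyclic group is abelian. If lifts of
    the reflections generate a p'-group fixing nothing in [P], [abelian_extension_of_cyclic_commg]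
    makes the whole preimage of [P] abelian, and [abelian_extension_splits] splits it. Gaschuetz's
    theorem carries the splitting to [G], where [cocycle_ext_splits] reads it as a coboundary. *)

(** * Frattini subgroups and coprime action *)

(** Some maximal subgroup does not contain [Z]; it is normal in the p-group [Q], and since [Z] has
    prime order it is a complement. *)
Lemma Phi_TI_splits (gT : finGroupType) (p : nat) (Q Z : {group gT}) :
  p.-group Q -> Z \subset Q -> prime #|Z| -> Z :&: 'Phi(Q) = 1 ->
  [splits Q, over Z].
Proof.
move=> pQ sZQ prZ tiZ.
have ntZ : ~~ (Z \subset 'Phi(Q)).
  by apply: contraL prZ => /setIidPl; rewrite tiZ => <-; rewrite cards1.
have [M maxM nZM] : exists2 M : {group gT}, maximal M Q & ~~ (Z \subset M).
  case: (pickP (fun M : {group gT} => maximal M Q && ~~ (Z \subset M))).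
    by move=> M /andP[]; exists M.
  move=> noM; case/negP: ntZ; apply/bigcapsP => M /predU1P[->//|maxM].
  by have := noM M; rewrite maxM /= => /negbFE.
apply/splitsP; exists M; apply/complP; split; first exact: prime_TIg.
have nsM := p_maximal_normal pQ maxM.
rewrite (normC (subset_trans sZQ (normal_norm nsM))).
exact: mulg_normal_maximal.
Qed.

(** [A] acts trivially on the quotient by [[~: G, A]], and coprimality lifts its fixed points to
    [G]. *)
Lemma coprime_comm_cent_prod (gT : finGroupType) (A G : {group gT}) :
    A \subset 'N(G) -> coprime #|G| #|A| -> solvable G ->
  [~: G, A] * 'C_G(A) = G.
Proof.
move=> nGA coGA solG; have sRG : [~: G, A] \subset G by rewrite commg_subl.
apply/eqP; rewrite eqEsubset mul_subG ?subsetIl //=.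
rewrite -quotientSK ?commg_norml // coprime_quotient_cent ?commg_normr //.
by rewrite subsetI subxx quotient_cents2r.
Qed.

Lemma mem_Ohm1_abelian (gT : finGroupType) (p : nat) (G : {group gT}) x :
  p.-group G -> abelian G ->
  (x \in 'Ohm_1(G)) = (x \in G) && (x ^+ p == 1).
Proof.
by move=> pG abG; rewrite (OhmEabelian pG) ?(abelianS (Ohm_sub 1 G)) // !inE.
Qed.

(** * Central extensions over an abelian subgroup *)

Section CentralExtension.

Variables (rT aT : finGroupType) (X : {group rT}) (f : {morphism X >-> aT}).
Variables (p : nat) (P : {group aT}).
Hypotheses (cXZ : X \subset 'C('ker f)) (sPX : P \subset f @* X).
Hypotheses (abP : abelian P).
Local Notation Q := (f @*^-1 P).

Lemma morphim_trivg_commg (A B : {set rT}) : A \subset X -> B \subset X ->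
  [~: f @* A, f @* B] = 1 -> [~: A, B] \subset 'ker f.
Proof.
move=> sAX sBX cAB.
by rewrite ker_trivg_morphim comm_subG // morphimR // cAB subxx.
Qed.

(* The preimages of [[~: P, <[s]>]] and of ['C_P(<[s]>)] generate [Q]. The    *)
(* first is abelian, as a central extension of a cyclic group, and it         *)
(* centralises the second by the three subgroup lemma.                        *)
Lemma commg_cyclic_sub_center (s : aT) :
    s \in f @* X -> s \in 'N(P) -> coprime #|P| #[s] ->
    cyclic [~: P, <[s]>] ->
  [~: P, <[s]>] \subset f @* 'Z(Q).
Proof.
case/morphimP=> t Xt _ -> nPs coPs cycR.
set R := [~: P, <[f t]>] in cycR *.
have nPS : <[f t]> \subset 'N(P) by rewrite cycle_subG.
have sRP : R \subset P by rewrite commg_subl.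
have sTX : <[t]> \subset X by rewrite cycle_subG.
have sQX : Q \subset X := subsetIl _ _.
have imQ : f @* Q = P by rewrite morphpreK.
have imT : f @* <[t]> = <[f t]> by rewrite morphim_cycle.
have sCQ : f @*^-1 'C_P(<[f t]>) \subset Q by rewrite morphpreS ?subsetIl.
have sCX := subset_trans sCQ sQX.
have imC : f @* (f @*^-1 'C_P(<[f t]>)) = 'C_P(<[f t]>).
  by rewrite morphpreK ?subIset ?sPX.
have cZ (A : {set rT}) : A \subset X -> 'ker f \subset 'C(A).
  by move=> sAX; rewrite centsC (subset_trans sAX).
have cRC : [~: [~: Q, <[t]>], f @*^-1 'C_P(<[f t]>)] = 1.
  have cTC : [~: <[t]>, f @*^-1 'C_P(<[f t]>)] \subset 'ker f.
    apply: morphim_trivg_commg => //; rewrite imT imC.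
    by apply/commG1P; rewrite centsC subsetIr.
  have cCQ : [~: f @*^-1 'C_P(<[f t]>), Q] \subset 'ker f.
    apply: morphim_trivg_commg => //; rewrite imQ imC.
    by apply/commG1P; apply: subset_trans (subsetIl _ _) abP.
  apply: three_subgroup; apply/commG1P.
    exact: subset_trans cTC (cZ _ sQX).
  exact: subset_trans cCQ (cZ _ sTX).
have defR : f @*^-1 R = 'ker f * [~: Q, <[t]>].
  rewrite -morphimK ?comm_subG //; congr (_ @*^-1 _).
  by rewrite morphimR // imQ imT.
have abR : abelian (f @*^-1 R).
  have [r defr] := cyclicP cycR.
  have /morphimP[x Xx _ frE] : r \in f @* X.
    by rewrite (subsetP (subset_trans sRP sPX)) // defr cycle_id.
  have sxX : <[x]> \subset X by rewrite cycle_subG.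
  rewrite defr frE -morphim_cycle // morphimK // abelianM cycle_abelian.
  by rewrite (subset_trans sxX cXZ) [abelian _]cZ // subsetIl.
have sRQ : f @*^-1 R \subset Q by rewrite morphpreS.
have sRZ : f @*^-1 R \subset 'Z(Q).
  rewrite subsetI sRQ centsC.
  have defQ : Q = f @*^-1 R * f @*^-1 'C_P(<[f t]>).
    rewrite -morphpreMl ?(subset_trans sRP) //.
    by rewrite coprime_comm_cent_prod ?abelian_sol.
  rewrite {1}defQ mul_subG // centsC {1}defR mul_subG ?cZ //.
  exact/commG1P.
by rewrite -(morphpreK (subset_trans sRP sPX)) morphimS.
Qed.

(** Modulo the image of ['Z(Q)], each generator of [K] centralises [P], hence so does [K]. As [P =
    [~: P, K]], this image is all of [P], and the kernel is central too. *)
Lemma abelian_extension_of_cyclic_commg (K : {group aT}) (A : {set aT}) :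
    K :=: <<A>> -> K \subset f @* X -> K \subset 'N(P) -> coprime #|P| #|K| ->
    {in A, forall s, cyclic [~: P, <[s]>]} -> 'C_P(K) = 1 ->
  abelian Q.
Proof.
move=> defK sKX nPK coPK cycA cPK.
have sQX : Q \subset X := subsetIl _ _.
have defPK : [~: P, K] = P.
  by rewrite -{2}(coprime_comm_cent_prod nPK) ?abelian_sol // cPK mulg1.
have imQ : f @* Q = P by rewrite morphpreK.
have nTK : K \subset 'N(f @* 'Z(Q)).
  have sKN : K \subset f @* 'N(Q).
    by rewrite morphim_normG ?ker_sub_pre // imQ subsetI sKX.
  exact: subset_trans sKN (morphim_norms _ (char_norms (center_char _))).
have sAK : A \subset K by rewrite defK subset_gen.
have sTP : f @* 'Z(Q) \subset P by rewrite -{2}imQ morphimS ?center_sub.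
have sPT : P \subset f @* 'Z(Q).
  rewrite -{1}defPK -quotient_cents2 ?(sub_abelian_norm abP) //.
  rewrite centsC defK quotient_gen ?(subset_trans sAK) // gen_subG.
  rewrite quotient_cents2r // commGC gen_subG.
  apply/subsetP=> _ /imset2P[x s Px As ->].
  have Ks := subsetP sAK _ As.
  have coPs : coprime #|P| #[s] by rewrite (coprimegS _ coPK) ?cycle_subG.
  have := commg_cyclic_sub_center (subsetP sKX _ Ks) (subsetP nPK _ Ks) coPs.
  by move/(_ (cycA _ As))/subsetP->; rewrite ?mem_commg ?cycle_id.
have sZX : 'Z(Q) \subset X := subset_trans (center_sub _) sQX.
have sQZ : Q \subset 'ker f * 'Z(Q).
  by rewrite -morphimK ?morphpreS.
have sZZ : 'ker f * 'Z(Q) \subset 'Z(Q).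
  rewrite mul_subG // subsetI ker_sub_pre //=.
  by rewrite centsC (subset_trans sQX).
by have := subset_trans sQZ sZZ; rewrite subsetI => /andP[].
Qed.

(* If [x ^+ p] lies in ['ker f], then [f x] lies in ['Ohm_1(P)], which is     *)
(* [[~: 'Ohm_1(P), K]]; and [[~ y, h]] has trivial [p]-th power when          *)
(* [y ^+ p] is central. So ['ker f] meets ['Phi(Q) = 'Mho^1(Q)] trivially.    *)
Lemma abelian_extension_splits (K : {group aT}) :
    prime p -> #|'ker f| = p -> p.-group P -> abelian Q ->
    K \subset f @* X -> K \subset 'N(P) -> coprime #|P| #|K| ->
    'C_P(K) = 1 ->
  [splits Q, over 'ker f].
Proof.
move=> p_pr oZ pP abQ sKX nPK coPK cPK.
have sZQ : 'ker f \subset Q by rewrite ker_sub_pre.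
have pQ : p.-group Q.
  by rewrite /pgroup card_morphpre // oZ pnatM pnat_id.
apply: (Phi_TI_splits pQ); rewrite ?oZ //.
apply/trivgP; rewrite /= (Phi_Mho pQ abQ) (MhoEabelian 1 pQ abQ) expn1.
apply/subsetP=> _ /setIP[/[swap] /imsetP[x Qx ->] Zxp].
have [Xx Pfx] := morphpreP Qx.
have nVK : K \subset 'N('Ohm_1(P)).
  exact: subset_trans nPK (char_norms (Ohm_char 1 P)).
have defV : [~: 'Ohm_1(P), K] = 'Ohm_1(P).
  have abV := abelianS (Ohm_sub 1 P) abP.
  rewrite -{2}(coprime_comm_cent_prod nVK) ?abelian_sol //; last first.
    exact: coprimeSg (Ohm_sub 1 P) coPK.
  suff ->: 'C_('Ohm_1(P))(K) = 1 by rewrite mulg1.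
  by apply/trivgP; rewrite -cPK setSI ?Ohm_sub.
have Vfx : f x \in 'Ohm_1(P).
  by rewrite (mem_Ohm1_abelian _ pP abP) Pfx -morphX // (mker Zxp) eqxx.
have sVU : 'Ohm_1(P) \subset f @* 'Ohm_1(Q).
  rewrite -{1}defV gen_subG; apply/subsetP=> _ /imset2P[v k Vv Kk ->].
  have Pv := subsetP (Ohm_sub 1 P) _ Vv.
  have /morphimP[y Xy _ def_v] := subsetP sPX _ Pv.
  have /morphimP[h Xh _ def_k] := subsetP sKX _ Kk.
  have Zyp : y ^+ p \in 'ker f.
    apply/kerP; rewrite ?groupX // morphX // -def_v.
    by move: Vv; rewrite (mem_Ohm1_abelian _ pP abP); case/andP=> _ /eqP.
  have Qy : y \in Q by rewrite mem_morphpre // -def_v.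
  have Qyh : y ^ h \in Q.
    rewrite mem_morphpre ?groupJ // morphJ // -def_v -def_k.
    by rewrite memJ_norm // (subsetP nPK).
  rewrite def_v def_k -morphR //; apply: mem_morphim; first exact: groupR.
  rewrite (mem_Ohm1_abelian _ pQ abQ).
  rewrite commgEl groupM ?groupV //= expgMn; last first.
    by apply: (centsP abQ); rewrite ?groupV.
  by rewrite -conjXg expgVn (conjgE _ h) -(centsP cXZ _ Xh _ Zyp) mulKg mulVg.
(* [x] differs from an element [u] with [u ^+ p = 1] by an element of the kernel, which has order
   [p]; hence [x ^+ p = 1]. *)
have /morphimP[u Xu Uu fxE] := subsetP sVU _ Vfx.
have up : u ^+ p = 1.
  by move: Uu; rewrite (mem_Ohm1_abelian _ pQ abQ); case/andP=> _ /eqP.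
have Zxu : x * u^-1 \in 'ker f.
  apply/kerP; rewrite ?groupM ?groupV // morphM ?groupV // morphV //.
  by rewrite fxE mulgV.
have: (x * u^-1) ^+ p = 1 by rewrite -oZ; apply: expg_cardG.
rewrite expgMn; last first.
  by apply: (centsP abQ); rewrite ?groupV // (subsetP (Ohm_sub 1 Q)).
by rewrite expgVn up invg1 mulg1 inE => ->.
Qed.

End CentralExtension.

(** * The central extension attached to a 2-cocycle *)

Section CocycleExtension.

Variables (gT : finGroupType) (A : finZmodType).
Variable f : cochain (gT * gT)%type A.

(** The type carries the cocycle proof so that the twisted group law, whose associativity depends on
    it, can be its canonical structure. *)
Definition cocycle_ext of f \in cocycles2 gT A : predArgType := (gT * A)%type.

Hypothesis fZ : f \in cocycles2 gT A.
Local Notation E := (cocycle_ext fZ).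

HB.instance Definition _ := Finite.copy E (gT * A)%type.

Let mul (x y : E) : E := (x.1 * y.1, (x.2 + y.2 + f (x.1, y.1))%R).
(** The cocycle is not assumed normalised, hence the corrections by [f (1, 1)]. *)
Let one : E := (1, (- f (1 : gT, 1 : gT)%g)%R).
Let inv (x : E) : E :=
  (x.1^-1, (- x.2 - f (x.1^-1%g, x.1) - f (1 : gT, 1 : gT)%g)%R).

Lemma cocycle2E g h k :
  (f (g, h) + f ((g * h)%g, k) = f (h, k) + f (g, (h * k)%g))%R.
Proof.
have /eqP/ffunP/(_ (g, h, k)) : cobound2 f == 0%R by move: fZ; rewrite inE.
rewrite !ffunE /= => /(canRL (subrK _)); rewrite add0r => <-.
by rewrite addrAC subrK.
Qed.

Lemma cocycle2_1l g : f (1 : gT, g)%g = f (1 : gT, 1 : gT)%g.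
Proof. by have := cocycle2E 1 1 g; rewrite !mul1g => /addIr. Qed.

Lemma cocycle2_1r g : f (g, 1 : gT)%g = f (1 : gT, 1 : gT)%g.
Proof. by have := cocycle2E g 1 1; rewrite !mulg1 addrC => /addIr. Qed.

Fact cocycle_ext_mulA : associative mul.
Proof.
move=> x y z; congr (_, _); rewrite /= ?mulgA //.
rewrite !addrA [RHS](ACl (1*2*4*(3*5)))%AC /= cocycle2E.
by rewrite !addrA.
Qed.

Fact cocycle_ext_mul1 : left_id one mul.
Proof.
case=> g a; congr (_, _); rewrite /= ?mul1g //.
by rewrite (cocycle2_1l g) addrAC addNr add0r.
Qed.

Fact cocycle_ext_mulV : left_inverse one inv mul.
Proof.
case=> g a; congr (_, _); rewrite /= ?mulVg //.
by rewrite [LHS](ACl ((1*4)*(2*5)*3))%AC /= !addNr !add0r.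
Qed.

HB.instance Definition _ := Finite_isGroup.Build E
  cocycle_ext_mulA cocycle_ext_mul1 cocycle_ext_mulV.

Definition cocycle_ext_proj (x : E) : gT := x.1.

Fact cocycle_ext_projM : {in setT &, {morph cocycle_ext_proj : x y / x * y}}.
Proof. by []. Qed.
Canonical cocycle_ext_proj_morphism := Morphism cocycle_ext_projM.

Lemma cocycle_ext_kerP (x : E) :
  reflect (x.1 = 1) (x \in 'ker cocycle_ext_proj).
Proof. by rewrite !inE; apply: eqP. Qed.

Lemma card_cocycle_ext_ker : #|'ker cocycle_ext_proj| = #|A|.
Proof.
have inj1 : injective (fun a : A => (1, a) : E) by move=> a b [].
rewrite -(card_image inj1); apply: eq_card => -[g a].
apply/cocycle_ext_kerP/imageP => /= [-> | [b _ [->]] //].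
by exists a.
Qed.

Lemma cocycle_ext_ker_central : [set: E] \subset 'C('ker cocycle_ext_proj).
Proof.
apply/centsP => -[g a] _ [h b] /cocycle_ext_kerP /= ->.
congr (_, _); first by rewrite /= mulg1 mul1g.
by rewrite /= (cocycle2_1l g) (cocycle2_1r g) [(a + b)%R]addrC.
Qed.

(** A complement is the graph of a function [u]. Closure under products gives
    [u (g * h) = u g + u h + f (g, h)], so [f] is the coboundary of [- u]. *)
Lemma cocycle_ext_splits :
  [splits [set: E], over 'ker cocycle_ext_proj] -> f \in cobounds2 gT A.
Proof.
case/splitsP=> M /complP[tiZM defE].
have sectP g : {a | ((g, a) : E) \in M}.
  apply/sigW; have : ((g, 0%R) : E) \in [set: E] by rewrite inE.
  rewrite -defE => /mulsgP[[h a] [g' b] /cocycle_ext_kerP /= -> Mgb].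
  by case; rewrite mul1g => ->; exists b.
pose u g := sval (sectP g); have Mu g : ((g, u g) : E) \in M := svalP (sectP g).
have uniM g a b : ((g, a) : E) \in M -> ((g, b) : E) \in M -> a = b.
  move=> Ma Mb; suff [] : ((g, a) : E) = (g, b) by [].
  apply/eqP; rewrite eq_mulgV1 -in_set1 -[[set 1]]tiZM inE.
  rewrite (groupM Ma) ?groupV // andbT; apply/cocycle_ext_kerP; apply: mulgV.
apply/imsetP; exists ([ffun g => - u g]%R : cochain gT A) => //.
apply/ffunP=> -[g h]; rewrite !ffunE /=.
have := uniM _ _ _ (groupM (Mu g) (Mu h)) (Mu (g * h)).
move <-; rewrite opprK !addrA.
by rewrite [RHS](ACl (5*2*(3*1)*4))%AC /= subrr addr0 addNr add0r.
Qed.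

End CocycleExtension.

(** * Reflections and cyclic commutator subgroups *)

Lemma commg_cycle_sub (gT : finGroupType) (V H : {group gT}) g :
    g \in 'N(V) -> {in V, forall x, [~ x, g] \in H} ->
  [~: V, <[g]>] \subset H.
Proof.
move=> nVg sVH; rewrite gen_subG.
apply/subsetP=> _ /imset2P[x _ Vx /cycleP[n ->] ->].
elim: n x Vx => [|n IHn] x Vx; first by rewrite commg1 group1.
rewrite expgS; have -> : [~ x, g * g ^+ n] = [~ x, g] * [~ x ^ g, g ^+ n].
  by rewrite !commgEl conjgM -mulgA mulKVg.
by rewrite groupM ?sVH ?IHn // memJ_norm.
Qed.

(** By coprime action [g] fixes no non-trivial element of [R = [~: P, <[g]>]], so ['Ohm_1(R)] is its
    own commutator with [g] and lies in [<[w]>]. An abelian group with cyclic ['Ohm_1] is cyclic. *)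
Lemma commg_cyclic_of_Ohm1 (gT : finGroupType) (P : {group gT}) g w :
    abelian P -> g \in 'N(P) -> coprime #|P| #[g] ->
    {in 'Ohm_1(P), forall x, [~ x, g] \in <[w]>} ->
  cyclic [~: P, <[g]>].
Proof.
move=> abP nPg coPg sVw.
have nPG : <[g]> \subset 'N(P) by rewrite cycle_subG.
set R := [~: P, <[g]>]; have sRP : R \subset P by rewrite commg_subl.
have abR := abelianS sRP abP.
have sUP := subset_trans (Ohm_sub 1 R) sRP.
have nUG : <[g]> \subset 'N('Ohm_1(R)).
  by rewrite (subset_trans (commg_normr _ P)) ?char_norms ?Ohm_char.
have cU1 : 'C_('Ohm_1(R))(<[g]>) = 1.
  by apply/trivgP; rewrite -(coprime_abel_cent_TI nPG coPg abP) setSI ?Ohm_sub.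
have sUw : 'Ohm_1(R) \subset <[w]>.
  rewrite -(coprime_comm_cent_prod nUG) ?(coprimeSg sUP) //; last first.
    by rewrite abelian_sol ?(abelianS sUP).
  rewrite cU1 mulg1 commg_cycle_sub -?cycle_subG // => x Ux.
  by rewrite sVw // (subsetP (OhmS 1 sRP)).
rewrite abelian_rank1_cyclic // -rank_Ohm1 -abelian_rank1_cyclic.
  exact: cyclicS sUw (cycle_cyclic w).
exact: abelianS (Ohm_sub 1 R) abR.
Qed.

Lemma reflection_commg_cyclic (p : nat) (gT : finGroupType) (G P : {group gT})
    (sylP : p.-Sylow(G) P) (abP : abelian P) (g : gT) :
    g \in 'N_G(P) -> coprime #|P| #[g] ->
    is_reflection (Omega1_act sylP abP (coset 'C_G(P) g)) ->
  cyclic [~: P, <[g]>].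
Proof.
move=> NPg coPg [_ _]; set s := Omega1_act _ _ _ => dim1.
(* Rank-nullity: the codimension of the fixed space is the dimension of the image, whose spanning
   vector supplies [w]. *)
have dim_im : \dim (limg (s - \1%VF)%R) = 1%N.
  by rewrite -dim1 -(limg_ker_dim (s - \1%VF)%R fullv) capfv addKn.
have [w im_w] : exists w, limg (s - \1%VF)%R = <[w]>%VS.
  exists (vpick (limg (s - \1%VF)%R)); apply/eqP; rewrite eq_sym eqEdim.
  by rewrite -memvE memv_pick dim_im dim_vline vpick0 -dimv_eq0 dim_im.
have [_ nPg] := setIP NPg.
apply: (@commg_cyclic_of_Ohm1 _ P g (sgval w)) => // x Vx.
pose v : Omega1_space sylP abP := subg 'Ohm_1(P) x.
have : (s - \1%VF)%R v \in <[w]>%VS by rewrite -im_w memv_img ?memvf.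
case/vlineP=> a.
rewrite add_lfunE opp_lfunE id_lfunE => /(congr1 (sgval : _ -> gT)).
have <- : (x ^ g * x^-1)%g = sgval (s v - v)%R.
  by rewrite -[x in LHS](@subgK _ 'Ohm_1(P)%G x Vx) -(Omega1_actE v NPg).
have -> : sgval (a *: w)%R = sgval w ^+ a.
  by rewrite -(morphX (sgval_morphism _)) ?inE.
have -> : x ^ g * x^-1 = [~ x, g].
  rewrite commgEl; apply: (centsP abP); rewrite ?groupV ?memJ_norm //;
  exact: subsetP (Ohm_sub 1 P) _ Vx.
by move->; apply: mem_cycle.
Qed.

(** * Fixed points of the reflection subgroup, and the conclusion *)

(** Cauchy's theorem gives an element of order [p] centralised by the lifts [A]; the reflection
    subgroup lies in the image of [<<A>>], so it fixes this vector. *)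
Lemma Omega1_fix_reflection_neq0 (p : nat) (gT : finGroupType)
    (G P : {group gT}) (sylP : p.-Sylow(G) P) (abP : abelian P)
    (A : {set gT}) :
    A \subset 'N_G(P) ->
    {in 'N_G(P) / 'C_G(P), forall e,
      is_reflection (Omega1_act sylP abP e) -> e \in A / 'C_G(P)} ->
    'C_P(<<A>>) != 1 ->
  Omega1_fix sylP abP (reflection_subgroup sylP abP) <> 0%VS.
Proof.
move=> sAN reflA ntC fix0.
have pP := pHall_pgroup sylP.
have pC : p.-group 'C_P(<<A>>) := pgroupS (subsetIl _ _) pP.
have [p_pr p_dv _] := pgroup_pdiv pC ntC.
have [x /setIP[Px Cx] ox] := Cauchy p_pr p_dv.
have Vx : x \in 'Ohm_1(P).
  by rewrite (mem_Ohm1_abelian _ pP abP) Px -ox expg_order eqxx.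
pose v : Omega1_space sylP abP := subg 'Ohm_1(P) x.
have vE : sgval v = x := @subgK _ 'Ohm_1(P)%G x Vx.
have : v \in Omega1_fix sylP abP (reflection_subgroup sylP abP).
  have nCA : A \subset 'N('C_G(P)) := subset_trans sAN (subcent_norm G P).
  rewrite memvE; apply/subv_bigcapP => e We; rewrite -memvE; apply/fixedSpaceP.
  have /morphimP[k _ Kk ->] : e \in <<A>> / 'C_G(P).
    rewrite quotient_gen //; apply: subsetP We; rewrite gen_subG.
    apply/subsetP=> d /[!inE] /andP[Nd /boolp.asboolP refl_d].
    by rewrite mem_gen // reflA.
  have Nk : k \in 'N_G(P) by apply: subsetP Kk; rewrite gen_subG.
  apply: val_inj; rewrite /= Omega1_actE // vE.
  by rewrite conjgE (centP Cx _ Kk) mulKg.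
rewrite fix0 memv0 => /eqP v0.
have x1 : x = 1 by rewrite -vE v0.
by have := prime_gt1 p_pr; rewrite -ox x1 order1.
Qed.

Theorem proposition3p5 (p : nat) (gT : finGroupType) (G P : {group gT})
    (p_pr : prime p) (p_gt2 : (2 < p)%N)
    (sylP : (p.-Sylow(G) P)%g) (abP : abelian P) :
  H2 (subg_of G) 'F_p <> 1%g ->
  Omega1_fix sylP abP (reflection_subgroup sylP abP) <> 0%VS.
Proof.
move=> H2nt; have pP := pHall_pgroup sylP.
have [f fZ nfB] : exists2 f, f \in cocycles2 (subg_of G) 'F_p
                           & f \notin cobounds2 (subg_of G) 'F_p.
  by apply/subsetPn/negP=> sZB; apply/H2nt/quotientS1.
have nsPN : P <| 'N_G(P) := normalSG (pHall_sub sylP).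
have hallP : Hall 'N_G(P) P.
  exact: pHall_Hall (pHall_subl (normal_sub nsPN) (subsetIl _ _) sylP).
have /splitsP[H /complP[tiPH defN]] := SchurZassenhaus_split hallP nsPN.
have sHN : H \subset 'N_G(P) by rewrite -defN mulG_subr.
have coPH : coprime #|P| #|H|.
  have [_] := andP hallP; rewrite -divgS ?normal_sub // -defN TI_cardMg //.
  by rewrite mulKn.
(* Lifts are taken inside the complement [H], so that the group they generate has order prime to
   that of [P]. *)
pose A := [set h in H |
  boolp.asbool (is_reflection (Omega1_act sylP abP (coset 'C_G(P) h)))].
have sAH : A \subset H by apply/subsetP=> h /[!inE] /andP[].
have sKH : <<A>> \subset H by rewrite gen_subG.
have sKN := subset_trans sKH sHN.
have coPK : coprime #|P| #|<<A>>| := coprimegS sKH coPH.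
have nPK : <<A>> \subset 'N(P) := subset_trans sKN (subsetIr _ _).
have sKG : <<A>> \subset G := subset_trans sKN (subsetIl _ _).
apply: (@Omega1_fix_reflection_neq0 _ _ _ _ _ _ A).
  exact: subset_trans sAH sHN.
  move=> _ /morphimP[n Nn NPn ->] refl_n.
  (* Since [P] is abelian, the [P]-part of [n] centralises [P], so [n] and its [H]-part define the
     same coset. *)
  have : n \in P * H by rewrite defN.
  case/mulsgP=> x h Px Hh def_n.
  have Cx : x \in 'C_G(P).
    by rewrite inE (subsetP (pHall_sub sylP)) // (subsetP abP).
  have Nh : h \in 'N('C_G(P)).
    by rewrite (subsetP (subcent_norm G P)) // (subsetP sHN).
  have def_e : coset 'C_G(P) n = coset 'C_G(P) h.
    by rewrite def_n coset_kerl.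
  rewrite /= def_e in refl_n *; apply: mem_morphim; rewrite // inE Hh.
  exact/boolp.asboolP.
apply/negP=> /eqP cPK; case/negP: nfB; apply: (@cocycle_ext_splits _ _ _ fZ).
(* The projection is composed with the inclusion of [G] in [gT], where [P] and [<<A>>] live. *)
pose pi (x : cocycle_ext fZ) : gT := sgval x.1.
have piM : {in [set: cocycle_ext fZ] &, {morph pi : x y / x * y}} by [].
pose pi_m := Morphism piM.
have kerE : 'ker pi_m = 'ker (@cocycle_ext_proj _ _ _ fZ).
  apply/setP=> x; rewrite !inE; apply/eqP/eqP=> [x1 | x1].
    exact: val_inj.
  by rewrite /= /pi [x.1]x1.
have im_pi : pi_m @* setT = G.
  apply/setP=> g; apply/morphimP/idP=> [[x _ _ ->] | Gg]; first exact: subgP.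
  by exists ((subg G g, 0%R) : cocycle_ext fZ); rewrite ?inE //= /pi subgK.
have sPX : P \subset pi_m @* setT by rewrite im_pi (pHall_sub sylP).
have sKX : <<A>> \subset pi_m @* setT by rewrite im_pi.
have cXZ : [set: cocycle_ext fZ] \subset 'C('ker pi_m).
  by rewrite kerE cocycle_ext_ker_central.
have oZ : #|'ker pi_m| = p by rewrite kerE card_cocycle_ext_ker card_Fp.
have cycA : {in A, forall s, cyclic [~: P, <[s]>]}.
  move=> s /[!inE] /andP[Hs /boolp.asboolP]; apply: reflection_commg_cyclic.
    exact: subsetP sHN _ Hs.
  by rewrite (coprimegS _ coPH) // cycle_subG.
have abQ : abelian (pi_m @*^-1 P).
  exact: (abelian_extension_of_cyclic_commg cXZ sPX abP (K := <<A>>%G)).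
have splitQ := abelian_extension_splits cXZ sPX abP p_pr oZ pP abQ
  (K := <<A>>%G) sKX nPK coPK cPK.
(* Gaschuetz applies as the kernel is abelian of order [p] and the preimage of [P] has index
   [#|G : P|], prime to [p]. *)
rewrite -kerE (@Gaschutz_split _ _ _ (pi_m @*^-1 P)%G) ?splitQ //.
- exact: ker_normal.
- exact: ker_sub_pre.
- exact: subsetT.
- by rewrite cyclic_abelian // prime_cyclic ?oZ.
have -> : #|[set: cocycle_ext fZ] : pi_m @*^-1 P| = #|G : P|.
  by rewrite -im_pi -(index_morphpre _ (subxx _)) morphimGK ?subsetT.
by have /and3P[_ _ p'iP] := sylP; rewrite oZ prime_coprime // -p'natE.
Qed.
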